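(* If $T$ is a tree with $\alpha(T)=|V(T)|/2$, then $T$ contains at least two pendant vertices such that the distance between them in $T$ is odd.
   Context: All graphs are finite, simple and undirected. A tree is a connected acyclic graph of order (number of vertices) greater than one. A set of vertices is stable if no two of its vertices are adjacent, and $\alpha(G)$ denotes the maximum cardinality of a stable set of $G$. A vertex $v$ of a graph $G$ is pendant if it has exactly one neighbor in $G$. *)

(* Defs.v *)
From mathcomp Require Import all_boot.

Set Implicit Arguments.
Unset Strict Implicit.
Unset Printing Implicit Defensive.

Record sgraph (V : finType) := SGraph {
  adj :> rel V;
  adj_sym : symmetric adj;
  adj_irrefl : irreflexive adj
}.

Section Graphs.
Variables (V : finType) (G : sgraph V).

Definition connected_graph : Prop := forall x y : V, connect G x y.

(* [cycle G c] also holds of [:: x; y] for every edge xy, hence the bound on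
   the length. *)
Definition acyclic : Prop :=
  forall c : seq V, 2 < size c -> uniq c -> ~~ cycle G c.

Definition is_tree : Prop := [/\ 1 < #|V|, connected_graph & acyclic].

Definition stable (S : {set V}) : bool :=
  [forall x in S, forall y in S, ~~ G x y].

Definition alpha : nat := \max_(S : {set V} | stable S) #|S|.

Definition neighbors (v : V) : {set V} := [set w | G v w].

Definition pendant (v : V) : bool := #|neighbors v| == 1.

Definition walk_of_length (x y : V) (n : nat) : bool :=
  [exists p : n.-tuple V, path G x p && (last x p == y)].

(* A shortest walk repeats no vertex, so it has fewer than #|V| edges and the
   search below finds its length; the value is #|V| when y is not reachable
   from x. *)
Definition dist (x y : V) : nat :=
  find (walk_of_length x y) (iota 0 #|V|).

End Graphs.

(* Main.v *)
Require Import Defs.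
From mathcomp Require Import all_boot.

Set Implicit Arguments.
Unset Strict Implicit.
Unset Printing Implicit Defensive.

(** Root a tree at a vertex [r], and call depth of a vertex its distance to [r].
    By acyclicity every vertex then has at most one neighbour that is not
    deeper than itself ([nbr_not_deeper_unique]): two such neighbours would be
    joined through [r] without passing through the vertex. Hence the depths of
    adjacent vertices differ by exactly one, and the vertices of even depth form
    a stable set.

    If no vertex of odd depth were pendant, each of them would have a child.
    Children are pairwise distinct, have even depth, and differ from the root,
    so there would be strictly fewer vertices of odd depth than of even depth
    ([card_odd_lt_even]). When the stability number is half the order, the even
    class has at most half of the vertices, which excludes this. So from every
    root there is a pendant vertex at odd distance ([pendant_at_odd_distance]).
    Applying this once, to an arbitrary root, yields a pendant vertex [u];
    applying it again with root [u] yields the second one. *)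

Section Distance.
Variables (V : finType) (G : sgraph V).

Lemma walk_of_lengthP (x y : V) (n : nat) :
  reflect (exists p, [/\ path G x p, last x p = y & size p = n])
          (walk_of_length G x y n).
Proof.
apply: (iffP existsP) => [[p /andP[Gp /eqP <-]]|[p [Gp lp /eqP sp]]].
  by exists p; rewrite size_tuple.
by exists (Tuple sp); rewrite /= Gp lp eqxx.
Qed.

Lemma dist_le_size (x y : V) (p : seq V) :
  path G x p -> last x p = y -> dist G x y <= size p.
Proof.
move=> Gp lp; rewrite leqNgt; apply/negP => lt_p.
have lt_V : size p < #|V|.
  by apply: leq_trans lt_p _; rewrite -[X in _ <= X](size_iota 0) find_size.
have := before_find 0 lt_p; rewrite nth_iota // add0n => /negbT/negP; apply.
by apply/walk_of_lengthP; exists p.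
Qed.

Lemma dist_walk (x y : V) : connect G x y ->
  exists p, [/\ path G x p, last x p = y & size p = dist G x y].
Proof.
case/connectP => p Gp ->; case/shortenP: Gp => q Gq Uq _.
have lt_q : size q < #|V| by have := max_card (mem (x :: q)); rewrite (card_uniqP Uq).
have hasw : has (walk_of_length G x (last x q)) (iota 0 #|V|).
  apply/hasP; exists (size q); first by rewrite mem_iota.
  by apply/walk_of_lengthP; exists q.
have := nth_find 0 hasw; rewrite nth_iota; last first.
  by rewrite -[X in _ < X](size_iota 0) -has_find.
by move/walk_of_lengthP.
Qed.

Lemma distxx (x : V) : dist G x x = 0.
Proof. by apply/eqP; rewrite -leqn0; apply: (@dist_le_size x x [::]). Qed.

Lemma dist_adj (x y r : V) : connect G y r -> G x y ->
  dist G x r <= (dist G y r).+1.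
Proof.
case/dist_walk => p [Gp lp <-] Gxy.
by apply: (@dist_le_size x r (y :: p)) => //=; rewrite Gxy.
Qed.

Lemma closer_nbr (x r : V) : connect G x r -> x != r ->
  exists2 y, G x y & dist G y r < dist G x r.
Proof.
case/dist_walk => -[|y p] /= [+ lp <-]; first by rewrite lp eqxx.
by case/andP=> Gxy Gp _; exists y => //; rewrite ltnS dist_le_size.
Qed.

End Distance.

Section RootedTree.
Variables (V : finType) (G : sgraph V) (r : V).
Hypotheses (G_conn : connected_graph G) (G_acyc : acyclic G).

Local Notation depth x := (dist G x r).

Definition adj_avoiding (x : V) : rel V :=
  fun y z => [&& G y z, y != x & z != x].

Lemma adj_avoiding_sym (x : V) : symmetric (adj_avoiding x).
Proof. by move=> y z; rewrite /adj_avoiding adj_sym [X in _ && X]andbC. Qed.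

(** Two neighbours of [x] joined by a path that avoids [x] would close up with
    [x] into a cycle. *)
Lemma nbrs_separated (x y z : V) :
  G x y -> G x z -> connect (adj_avoiding x) y z -> y = z.
Proof.
move=> Gxy Gxz /connectP[p Ap lp]; move: lp; case/shortenP: Ap => q Aq Uq _ lq.
case: q => [|t q] // in Aq Uq lq *.
have Gq : path G y (t :: q) by apply: sub_path Aq => a b /and3P[].
have xNq : x \notin y :: t :: q.
  have xy : x != y by case/andP: Aq => /and3P[_ + _] _; rewrite eq_sym.
  rewrite inE negb_or xy /=.
  elim: (t :: q) (y) Aq => //= a s IHs b /andP[/and3P[_ _ ax] /IHs xs].
  by rewrite inE negb_or eq_sym ax.
have Gc : cycle G [:: x, y, t & q].
  by rewrite (cycle_path x) /= -[last t q]/(last y (t :: q)) -lq adj_sym Gxz Gxy.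
by have := @G_acyc [:: x, y, t & q] isT; rewrite cons_uniq xNq Uq Gc => /(_ isT).
Qed.

(** A shortest walk to the root descends strictly, so after its first vertex it
    only meets vertices of depth less than that of [x]. *)
Lemma connect_root_avoiding (x y : V) :
  y != x -> depth y <= depth x -> connect (adj_avoiding x) y r.
Proof.
elim/ltn_ind: {y}(depth y) {-2}y (erefl (depth y)) => n IHn y dy yx.
rewrite dy => le_nx; have [->|y_r] := eqVneq y r; first exact: connect0.
have [z Gyz] := closer_nbr (G_conn y r) y_r; rewrite dy => lt_z.
have lt_zx := leq_trans lt_z le_nx.
have zx : z != x by apply: contraTneq lt_zx => ->; rewrite ltnn.
apply: connect_trans (connect1 _) (IHn _ lt_z z _ zx (ltnW lt_zx)) => //.
by rewrite /adj_avoiding Gyz yx.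
Qed.

Lemma nbr_not_deeper_unique (x y z : V) : G x y -> G x z ->
  depth y <= depth x -> depth z <= depth x -> y = z.
Proof.
have nbr_neq t : G x t -> t != x by apply: contraTneq => ->; rewrite adj_irrefl.
move=> Gxy Gxz dy dz; apply: (nbrs_separated Gxy Gxz).
apply: connect_trans (connect_root_avoiding (nbr_neq _ Gxy) dy) _.
rewrite (sym_connect_sym (adj_avoiding_sym x)).
exact: connect_root_avoiding (nbr_neq _ Gxz) dz.
Qed.

(** An equally deep neighbour would compete with the parent in
    [nbr_not_deeper_unique]. *)
Lemma depth_adj_neq (x y : V) : G x y -> depth x != depth y.
Proof.
move=> Gxy; apply/eqP => dxy; have [x_r|x_r] := eqVneq x r.
  have [y_r|y_r] := eqVneq y r; first by rewrite x_r y_r adj_irrefl in Gxy.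
  have [z _] := closer_nbr (G_conn y r) y_r.
  by rewrite -dxy x_r distxx.
have [z Gxz lt_z] := closer_nbr (G_conn x r) x_r.
have yz : y = z by apply: (nbr_not_deeper_unique Gxy Gxz); rewrite ?dxy // -dxy ltnW.
by rewrite -yz dxy ltnn in lt_z.
Qed.

Lemma odd_depth_adj (x y : V) : G x y -> odd (depth y) = ~~ odd (depth x).
Proof.
move=> Gxy; have Gyx : G y x by rewrite adj_sym.
have := dist_adj (G_conn y r) Gxy; have := dist_adj (G_conn x r) Gyx.
have := depth_adj_neq Gxy; case: (ltngtP (depth x) (depth y)) => // lt_xy _ le1 le2.
  by have -> : depth y = (depth x).+1 by apply/eqP; rewrite eqn_leq le1.
have -> : depth x = (depth y).+1 by apply/eqP; rewrite eqn_leq le2.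
by rewrite /= negbK.
Qed.

Definition odd_class : {set V} := [set x | odd (depth x)].

Lemma stable_even_class : stable G (~: odd_class).
Proof.
apply/forall_inP => x; rewrite !inE => x_even; apply/forall_inP => y.
by rewrite !inE; apply: contra => /odd_depth_adj ->.
Qed.

(** One neighbour is the parent; any further one must be deeper, since the
    parent is the only neighbour that is not. *)
Lemma child_of_nonpendant (x : V) : x != r -> ~~ pendant G x ->
  exists2 y, G x y & depth x < depth y.
Proof.
move=> x_r; have [p Gxp dp] := closer_nbr (G_conn x r) x_r.
rewrite /pendant (cardsD1 p) inE Gxp eqSS cards_eq0 => /set0Pn[y].
rewrite !inE => /andP[yp Gxy]; exists y => //; rewrite ltnNge.
by apply: contra_neqN yp => dy; apply: (nbr_not_deeper_unique Gxy Gxp) (ltnW dp).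
Qed.

(** Mapping a vertex to its parent sends the non-root vertices of even depth
    onto the odd class as soon as each vertex of odd depth has a child. *)
Lemma card_odd_lt_even :
  {in odd_class, forall x, ~~ pendant G x} -> #|odd_class| < #|~: odd_class|.
Proof.
move=> no_pendant.
pose parent z := odflt z [pick y | G z y && (depth y < depth z)].
have r_even : r \in ~: odd_class by rewrite !inE distxx.
rewrite (cardsD1 r (~: _)) r_even ltnS.
apply: leq_trans (leq_imset_card parent _); apply/subset_leq_card/subsetP=> x xO.
have x_r : x != r by apply: contraTneq xO => ->; rewrite inE distxx.
have [z Gxz dz] := child_of_nonpendant x_r (no_pendant x xO).
have Gzx : G z x by rewrite adj_sym.
apply/imsetP; exists z.
  rewrite !inE (odd_depth_adj Gxz) negbK; rewrite inE in xO; rewrite xO andbT.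
  by apply: contraTneq dz => ->; rewrite distxx.
rewrite /parent; case: pickP => [y /andP[Gzy dy]|/(_ x)]; last by rewrite Gzx dz.
by apply: (nbr_not_deeper_unique Gzx Gzy); apply: ltnW.
Qed.

(** The even class, being stable, has at most half of the vertices, so the
    strict inequality of [card_odd_lt_even] is impossible. *)
Lemma pendant_at_odd_distance : #|V| >= (alpha G).*2 ->
  exists2 v, pendant G v & odd (dist G v r).
Proof.
move=> le_alpha; suff /exists_inP[v] : [exists v in odd_class, pendant G v].
  by rewrite inE; exists v.
apply: contraT; rewrite negb_exists_in => /forall_inP/card_odd_lt_even lt_card.
have le_even : #|~: odd_class| <= alpha G.
  exact: (leq_bigmax_cond (F := fun S : {set V} => #|S|) _ stable_even_class).
suff : #|V| < (alpha G).*2 by rewrite ltnNge le_alpha.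
rewrite -(cardsC odd_class) -addnn -addSn.
by apply: leq_add => //; apply: leq_trans le_even.
Qed.

End RootedTree.

Theorem corollary2p4 (V : finType) (T : sgraph V)
    (T_tree : is_tree T) (T_alpha : (alpha T).*2 = #|V|) :
  exists u v : V, [/\ u != v, pendant T u, pendant T v & odd (dist T u v)].
Proof.
case: T_tree => V_gt1 T_conn T_acyc.
have le_alpha : (alpha T).*2 <= #|V| by rewrite T_alpha.
have /card_gt0P[r _] : 0 < #|V| by apply: ltnW.
have [v v_pend _] := pendant_at_odd_distance r T_conn T_acyc le_alpha.
have [u u_pend u_odd] := pendant_at_odd_distance v T_conn T_acyc le_alpha.
exists u, v; split=> //.
by apply: contraTneq u_odd => ->; rewrite distxx.
Qed.
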